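(* For every integer $k \geq 1$, there are, up to isomorphism, only finitely many $k$-vertex-critical $(P_5,\text{chair})$-free graphs.
   Context: All graphs are finite and simple. For graphs $G, F_1, F_2$, $G$ is $(F_1,F_2)$-free if neither $F_1$ nor $F_2$ is (isomorphic to) an induced subgraph of $G$. $\chi(G)$ denotes the chromatic number of $G$. A graph $G$ is $k$-vertex-critical if $\chi(G)=k$ but $\chi(G-v)<k$ for every vertex $v\in V(G)$. $P_5$ is the path on $5$ vertices. The chair is the $5$-vertex graph obtained from a path on $4$ vertices by adding a pendant vertex (a new vertex of degree one) adjacent to one of the two central vertices of the path. *)

(* Defs.v *)
From mathcomp Require Import all_boot.

Set Implicit Arguments.
Unset Strict Implicit.
Unset Printing Implicit Defensive.

Record sgraph := SGraph {
  vertex :> finType;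
  edge : rel vertex;
  edge_sym : symmetric edge;
  edge_irr : irreflexive edge }.

Definition isomorphic (G H : sgraph) : Prop :=
  exists2 f : G -> H,
    bijective f & {mono f : x y / @edge G x y >-> @edge H x y}.

Section Induced.
Variables (G : sgraph) (A : {set G}).

Definition induced_edge : rel {x : G | x \in A} :=
  fun x y => edge (val x) (val y).

Lemma induced_edge_sym : symmetric induced_edge.
Proof. by move=> x y; apply: edge_sym. Qed.

Lemma induced_edge_irr : irreflexive induced_edge.
Proof. by move=> x; apply: edge_irr. Qed.

Definition induced : sgraph := SGraph induced_edge_sym induced_edge_irr.

End Induced.

Definition delete_vertex (G : sgraph) (v : G) : sgraph := induced [set~ v].

Definition contains_induced (G F : sgraph) : Prop :=
  exists A : {set G}, isomorphic F (induced A).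

Definition free2 (F1 F2 G : sgraph) : Prop :=
  ~ contains_induced G F1 /\ ~ contains_induced G F2.

Definition proper_coloring (G : sgraph) (k : nat) (c : {ffun G -> 'I_k}) : bool :=
  [forall x, forall y, edge x y ==> (c x != c y)].

Definition colorable (G : sgraph) (k : nat) : bool :=
  [exists c : {ffun G -> 'I_k}, proper_coloring c].

Lemma colorable_ex (G : sgraph) : exists k, colorable G k.
Proof.
exists #|G|; apply/existsP; exists [ffun x => enum_rank x].
apply/forallP=> x; apply/forallP=> y; apply/implyP=> xy; rewrite !ffunE.
by apply: contraTneq xy => /enum_rank_inj->; rewrite edge_irr.
Qed.

Definition chromatic_number (G : sgraph) : nat := ex_minn (colorable_ex G).

Definition vertex_critical (k : nat) (G : sgraph) : Prop :=
  chromatic_number G = k /\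
  forall v : G, chromatic_number (delete_vertex v) < k.

Section PathGraph.
Variable n : nat.

Definition path_edge : rel 'I_n := fun i j => (i.+1 == j) || (j.+1 == i).

Lemma path_edge_sym : symmetric path_edge.
Proof. by move=> i j; rewrite /path_edge orbC. Qed.

Lemma path_edge_irr : irreflexive path_edge.
Proof. by move=> i; rewrite /path_edge orbb gtn_eqF. Qed.

Definition path_graph : sgraph := SGraph path_edge_sym path_edge_irr.

End PathGraph.

Section Pendant.
Variables (G : sgraph) (v : G).

(* [None] is the new vertex; its only neighbour is [Some v]. *)
Definition pendant_edge : rel (option G) := fun x y =>
  match x, y with
  | Some a, Some b => edge a b
  | Some a, None => a == v
  | None, Some b => b == v
  | None, None => false
  end.

Lemma pendant_edge_sym : symmetric pendant_edge.
Proof. by move=> [a|] [b|] //=; apply: edge_sym. Qed.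

Lemma pendant_edge_irr : irreflexive pendant_edge.
Proof. by move=> [a|] //=; apply: edge_irr. Qed.

Definition add_pendant : sgraph := SGraph pendant_edge_sym pendant_edge_irr.

End Pendant.

Definition P5 : sgraph := path_graph 5.

(* The path on 0, 1, 2, 3 has central vertices 1 and 2. *)
Definition chair : sgraph :=
  @add_pendant (path_graph 4) (Ordinal (isT : 1 < 4)).

Definition finitely_many_up_to_iso (P : sgraph -> Prop) : Prop :=
  exists (n : nat) (L : 'I_n -> sgraph),
    forall G : sgraph, P G -> exists i : 'I_n, isomorphic G (L i).

(* Main.v *)
Require Import Defs.
From mathcomp Require Import all_boot.

Set Implicit Arguments.
Unset Strict Implicit.
Unset Printing Implicit Defensive.

(* Cliques in [G] have at most [k] vertices, so if [G] is large, some set [Q] has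
   a common neighbourhood with many components ([many_components]). Let [C0] be
   one of minimum chromatic number. By criticality, for every other component
   [C] some vertex [p] outside [C0] has a neighbour in [C0] but misses a vertex
   [c] of [C]; then [p] is not adjacent to some [v] in [Q], and chair-freeness
   around [v] makes [p] complete to all components other than [C0] and [C].
   The pairs [(p, c)] thus form a complete bipartite graph minus a perfect
   matching, up to edges among the [p]'s. As cliques are bounded, three of the
   [p]'s are independent, giving an induced 6-cycle, hence an induced [P5]. *)

(** * Exhibiting [P5] and the chair as induced subgraphs *)

Lemma contains_induced_embedding (G F : sgraph) (f : F -> G) :
  injective f -> {mono f : x y / @edge F x y >-> @edge G x y} ->
  contains_induced G F.
Proof.
move=> f_inj f_mono; pose A := [set f x | x in F].
have fA x : f x \in A by apply: imset_f.
exists A; exists (fun x => exist _ (f x) (fA x) : induced A); last first.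
  by move=> x y; apply: f_mono.
have inj_h : injective (fun x => exist _ (f x) (fA x) : induced A).
  by move=> x y /(congr1 val) /f_inj.
apply: inj_card_bij inj_h _.
by rewrite card_sig card_imset // cardT.
Qed.

Lemma contains_P5 (G : sgraph) (a b c d e : G) :
  edge a b -> edge b c -> edge c d -> edge d e ->
  ~~ edge a c -> ~~ edge a d -> ~~ edge a e ->
  ~~ edge b d -> ~~ edge b e -> ~~ edge c e -> contains_induced G P5.
Proof.
move=> ab bc cd de /negPf ac /negPf ad /negPf ae /negPf bd /negPf be /negPf ce.
pose f (i : P5) := nth a [:: a; b; c; d; e] (i : 'I_5).
have f_mono : {mono f : x y / @edge P5 x y >-> @edge G x y}.
  move=> [[|[|[|[|[|i]]]]] Hi] [[|[|[|[|[|j]]]]] Hj] //;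
  by rewrite /= /path_edge /f /= ?edge_irr // ?[edge b a]edge_sym
    ?[edge c a]edge_sym ?[edge c b]edge_sym ?[edge d _]edge_sym
    ?[edge e _]edge_sym ?ab ?bc ?cd ?de ?ac ?ad ?ae ?bd ?be ?ce.
apply: (@contains_induced_embedding _ _ f) (f_mono) => x y fxy.
(* Injectivity is automatic: equal images force equal neighbourhoods, and no two vertices of [P5]
   share one, as adjacency to 0, 1, 2 and 3 already shows. *)
have exy z : @edge P5 x z = @edge P5 y z by rewrite -!f_mono fxy.
apply/val_inj; case: x y exy {fxy} => [[|[|[|[|[|i]]]]] Hi]
  [[|[|[|[|[|j]]]]] Hj] // exy; exfalso;
  move: (exy (@Ordinal 5 0 isT)) (exy (@Ordinal 5 1 isT))
        (exy (@Ordinal 5 2 isT)) (exy (@Ordinal 5 3 isT)); done.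
Qed.

(** Here [v] is the vertex of degree three, with leaves [b], [c] and long arm [a], [p]. The two
    leaves are twins, so adjacency cannot tell them apart and [b != c] is assumed. *)
Lemma contains_chair (G : sgraph) (v a b c p : G) :
  edge v a -> edge v b -> edge v c -> edge p a -> b != c ->
  ~~ edge a b -> ~~ edge a c -> ~~ edge b c ->
  ~~ edge p v -> ~~ edge p b -> ~~ edge p c -> contains_induced G chair.
Proof.
move=> va vb vc pa bc' /negPf ab /negPf ac /negPf bc /negPf pv /negPf pb /negPf pc.
pose f (i : chair) : G :=
  if i is Some j then nth v [:: b; v; a; p] (j : 'I_4) else c.
have f_mono : {mono f : x y / @edge chair x y >-> @edge G x y}.
  move=> [[[|[|[|[|i]]]] Hi]|] [[[|[|[|[|j]]]] Hj]|] //;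
  rewrite /= /path_edge /f /= ?edge_irr //;
  by rewrite ?[edge b a]edge_sym ?[edge _ v]edge_sym ?[edge _ p]edge_sym
     ?[edge c a]edge_sym ?[edge c b]edge_sym ?pv ?(edge_sym v p)
     ?pv ?va ?vb ?vc ?pa ?ab ?ac ?bc ?pb ?pc.
apply: (@contains_induced_embedding _ _ f) (f_mono) => x y fxy.
have exy z : @edge chair x z = @edge chair y z by rewrite -!f_mono fxy.
move: fxy.
case: x y exy => [[[|[|[|[|i]]]] Hi]|] [[[|[|[|[|j]]]] Hj]|] // exy fxy;
  try (by congr Some; apply: val_inj);
  try (by move: bc'; rewrite /f /= in fxy; rewrite fxy eqxx);
  by move: (exy (Some (@Ordinal 4 0 isT))) (exy (Some (@Ordinal 4 1 isT)))
        (exy (Some (@Ordinal 4 2 isT))) (exy (Some (@Ordinal 4 3 isT))) (exy None).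
Qed.

Lemma card_bigcup_le (I T : finType) (X : {set I}) (F : I -> {set T}) (d : nat) :
  (forall i, i \in X -> #|F i| <= d) -> #|\bigcup_(i in X) F i| <= #|X| * d.
Proof.
move=> Fd; rewrite -sum_nat_const.
elim/big_rec2: _ => [|i B n iX IH]; first by rewrite cards0.
by apply: leq_trans (leq_card_setU _ _) _; apply: leq_add => //; apply: Fd.
Qed.

(** * Bounded cliques and independent triples *)

Section Cliques.
Variable G : sgraph.

Definition nbrs (x : G) : {set G} := [set y | edge x y].

Definition clique (K : {set G}) : Prop :=
  {in K &, forall x y, x != y -> edge x y}.

Definition clique_bounded (A : {set G}) (w : nat) : Prop :=
  forall K : {set G}, K \subset A -> clique K -> #|K| <= w.

Lemma clique_bounded_nbrs (A : {set G}) (w : nat) (v : G) :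
  v \in A -> clique_bounded A w.+1 -> clique_bounded (A :&: nbrs v) w.
Proof.
move=> vA Aw K; rewrite subsetI => /andP[KA /subsetP Kv] Kc.
have vK : v \notin K by apply/negP => /Kv; rewrite inE edge_irr.
have := Aw (v |: K); rewrite cardsU1 vK; apply.
  by rewrite subUset sub1set vA.
move=> x y /setU1P[->|xK] /setU1P[->|yK]; rewrite ?eqxx // => xy.
- by have := Kv _ yK; rewrite inE.
- by have := Kv _ xK; rewrite inE edge_sym.
- exact: Kc.
Qed.

(** A quadratic Ramsey bound by induction on [w]: either some vertex [v] has a large neighbourhood
    in [A], where cliques are smaller, or its non-neighbours are too many to form a clique and
    contain a non-adjacent pair, completed by [v]. *)
Lemma three_independent (A : {set G}) (w : nat) :
  clique_bounded A w -> w.+1 ^ 2 < #|A| ->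
  exists x y z : G, [/\ x \in A, y \in A & z \in A] /\
    [/\ x != y, x != z & y != z] /\
    [/\ ~~ edge x y, ~~ edge x z & ~~ edge y z].
Proof.
elim: w A => [|w IH] A Aw cA.
  have [x xA] : exists x, x \in A by apply/card_gt0P/(leq_trans _ cA).
  have: #|[set x]| <= 0.
    by apply: Aw => [|a b /set1P-> /set1P->]; rewrite ?sub1set ?eqxx.
  by rewrite cards1.
have [v vA] : exists x, x \in A by apply/card_gt0P/(leq_trans _ cA).
have [big|small] := ltnP (w.+1 ^ 2) #|A :&: nbrs v|.
  have [x [y [z [[]]]]] := IH _ (clique_bounded_nbrs vA Aw) big.
  rewrite !inE => /andP[? _] /andP[? _] /andP[? _] ?.
  by exists x, y, z.
pose R := A :\: nbrs v :\ v.
have [x xR [y yR [xy nxy]]] :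
    exists2 x, x \in R & exists2 y, y \in R & x != y /\ ~~ edge x y.
  (* The squares of [w.+2] and [w.+1] differ by 2w+3; the strict bound on [#|A|] pays for removing
     [v]. *)
  have cR : w.+1 < #|R|.
    have := cardsD1 v (A :\: nbrs v); rewrite !inE edge_irr vA /= => cR.
    have := cardsID (nbrs v) A; rewrite cR => cA'.
    move: cA; rewrite -cA' add1n addnS ltnS => cA.
    have : w.+2 ^ 2 <= w.+1 ^ 2 + #|R| by apply: leq_trans cA _; rewrite leq_add2r.
    apply: contraTT; rewrite -leqNgt -ltnNge => Rw.
    apply: leq_ltn_trans (leq_add (leqnn _) Rw) _.
    by rewrite -[w.+2]addn1 sqrnD -addnA ltn_add2l muln1 mul2n exp1n add1n ltnS
      -addnn leq_addr.
  have [/existsP[x /existsP[y /and4P[xR yR xy nxy]]]|] := boolP [exists x, exists y,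
    [&& x \in R, y \in R, x != y & ~~ edge x y]].
    by exists x => //; exists y.
  rewrite negb_exists => /forallP none.
  have: #|R| <= w.+1.
    apply: Aw; first by apply/subsetP => x; rewrite !inE => /and3P[].
    move=> x y xR yR xy; have := none x; rewrite negb_exists => /forallP/(_ y).
    by rewrite xR yR xy /= negbK.
  by rewrite leqNgt cR.
move: xR yR; rewrite !inE => /and3P[xv nvx xA] /and3P[yv nvy yA].
by exists x, y, v; do !split=> //; rewrite edge_sym.
Qed.

End Cliques.

(** * Components and balls in an induced subgraph *)

Section Components.
Variables (G : sgraph) (A : {set G}).

(** Taken on all of [G] rather than on [induced A], to avoid subtypes; vertices outside [A] are
    isolated. *)
Definition inner_edge : rel G := [rel x y | [&& x \in A, y \in A & edge x y]].

Lemma inner_connect_sym : connect_sym inner_edge.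
Proof.
by apply: sym_connect_sym => x y; rewrite /inner_edge /= edge_sym andbCA.
Qed.

Definition component (x : G) : {set G} := [set y | connect inner_edge x y].

(** For [T] inside [A], [#|T|] then bounds the number of components of [A] from below. *)
Definition separated (T : {set G}) : Prop :=
  {in T &, forall x y, connect inner_edge x y -> x = y}.

Lemma component_sub (x : G) : x \in A -> component x \subset A.
Proof.
move=> xA; apply/subsetP => y; rewrite inE => xy.
rewrite -(closed_connect _ xy) //.
by apply: (intro_closed inner_connect_sym) => u v /and3P[].
Qed.

Lemma component_edge (x a p : G) :
  x \in A -> a \in component x -> p \in A -> edge a p -> p \in component x.
Proof.
move=> xA aC pA ap; have aA := subsetP (component_sub xA) _ aC.
rewrite !inE in aC *; apply: connect_trans aC (connect1 _).
by rewrite /inner_edge /= aA pA.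
Qed.

Lemma component_disjoint (T : {set G}) (s t a : G) :
  separated T -> s \in T -> t \in T ->
  a \in component s -> a \in component t -> s = t.
Proof.
move=> sepT sT tT; rewrite !inE => sa ta; apply: sepT => //.
by apply: connect_trans sa _; rewrite inner_connect_sym.
Qed.

Lemma component_anticomplete (T : {set G}) (s t a b : G) :
  T \subset A -> separated T -> s \in T -> t \in T -> s != t ->
  a \in component s -> b \in component t -> ~~ edge a b.
Proof.
move=> /subsetP TA sepT sT tT /eqP st aC bC; apply/negP => ab; apply: st.
apply: (component_disjoint sepT sT tT _ bC).
apply: (component_edge (TA _ sT) aC _ ab).
exact: (subsetP (component_sub (TA _ tT))).
Qed.

Definition ball_step (X : {set G}) : {set G} :=
  X :|: \bigcup_(x in X) (A :&: nbrs x).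

Definition ball (r : nat) (x : G) : {set G} := iter r ball_step [set x].

Lemma ballS (r : nat) (x y : G) :
  reflect (y \in ball r x \/ exists2 z, z \in ball r x & (y \in A) && edge z y)
    (y \in ball r.+1 x).
Proof.
rewrite /ball iterS in_setU; apply: (iffP orP) => -[H|H]; [by left| |by left|].
  by right; case/bigcupP: H => z zB; rewrite !inE; exists z.
by right; case: H => z zB zy; apply/bigcupP; exists z; rewrite // !inE.
Qed.

Lemma ball_sub (r : nat) (x : G) : x \in A -> ball r x \subset A.
Proof.
move=> xA; elim: r => [|r IH]; first by rewrite sub1set.
apply/subsetP => y /ballS[/(subsetP IH) //|[z _ /andP[]] //].
Qed.

Lemma card_ball (r d : nat) (x : G) :
  x \in A -> (forall y, y \in A -> #|A :&: nbrs y| <= d) ->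
  #|ball r x| <= d.+1 ^ r.
Proof.
move=> xA Ad; elim: r => [|r IH]; first by rewrite cards1.
apply: leq_trans (leq_card_setU _ _) _.
apply: leq_trans (leq_add (leqnn _) (card_bigcup_le (d := d) _)) _.
  by move=> y /(subsetP (ball_sub r xA)); apply: Ad.
by rewrite -mulnS expnSr leq_mul2r IH orbT.
Qed.

(** Otherwise some vertex is at distance exactly four from [x] in [A], and a shortest path to it is
    an induced [P5]. *)
Lemma component_sub_ball (x : G) :
  ~ contains_induced G P5 -> x \in A -> component x \subset ball 3 x.
Proof.
move=> noP5 xA; apply/subsetP => y; rewrite inE => xy.
have x3 : x \in ball 3 x by do 3!(apply/ballS; left); rewrite inE.
rewrite -(closed_connect _ xy) //.
apply: (intro_closed inner_connect_sym) => d e /and3P[dA eA de] d3.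
apply/negPn/negP => e3.
have out r z u : z \in A -> z \notin ball r.+1 x -> u \in ball r x -> ~~ edge u z.
  by move=> zA zr ur; apply: contra zr => uz; apply/ballS; right; exists u; rewrite ?zA.
have mono r z : z \notin ball r.+1 x -> z \notin ball r x.
  by apply: contra => zr; apply/ballS; left.
have layer r z : z \in ball r.+1 x -> z \notin ball r x ->
    exists2 u, u \in ball r x & (z \in A) && edge u z.
  by case/ballS => [->|].
(* Walk back from [e] through the layers to [a], which is [x]; by [out], non-consecutive layers are
   anticomplete. *)
have d2 : d \notin ball 2 x by apply: contraL de; exact: out e3.
have [c c2 /andP[_ cd]] := layer _ _ d3 d2.
have c1 : c \notin ball 1 x by apply: contraL cd; exact: out d2.
have [b b1 /andP[cA bc]] := layer _ _ c2 c1.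
have b0 : b \notin ball 0 x by apply: contraL bc; exact: out c1.
have [a a0 /andP[bA ab]] := layer _ _ b1 b0.
have a1 : a \in ball 1 x by apply/ballS; left.
have a2 : a \in ball 2 x by apply/ballS; left.
have b2 : b \in ball 2 x by apply/ballS; left.
apply: noP5; apply: (contains_P5 ab bc cd de).
- exact: out c1 a0.
- exact: out d2 a1.
- exact: out e3 a2.
- exact: out d2 b1.
- exact: out e3 b2.
- exact: out e3 c2.
Qed.

(** Take one root per component: each component fits in a ball of at most [d.+1 ^ 3] vertices, so
    fewer than [m] of them cannot cover [A]. *)
Lemma separated_of_bounded_degree (m d : nat) :
  ~ contains_induced G P5 -> (forall y, y \in A -> #|A :&: nbrs y| <= d) ->
  m * d.+1 ^ 3 < #|A| ->
  exists T : {set G}, [/\ T \subset A, separated T & m <= #|T|].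
Proof.
move=> noP5 Ad cA; pose T := [set root inner_edge x | x in A].
have rootA x : x \in A -> root inner_edge x \in A.
  by move=> xA; apply: (subsetP (component_sub xA)); rewrite inE connect_root.
have TA : T \subset A by apply/subsetP => _ /imsetP[x xA ->]; apply: rootA.
exists T; split=> //.
  move=> _ _ /imsetP[x xA ->] /imsetP[y yA ->].
  move/(rootP inner_connect_sym).
  by rewrite !(root_root inner_connect_sym).
rewrite leqNgt; apply/negP => Tm; move: cA; apply/negP; rewrite -leqNgt.
apply: (@leq_trans #|\bigcup_(t in T) ball 3 t|); last first.
  apply: leq_trans (card_bigcup_le (d := d.+1 ^ 3) _) _.
    by move=> t tT; apply: card_ball => //; apply: subsetP TA _ tT.
  by rewrite leq_mul2r ltnW ?orbT.
apply/subset_leq_card/subsetP => x xA; apply/bigcupP.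
exists (root inner_edge x); first exact: imset_f.
apply: (subsetP (component_sub_ball noP5 (rootA _ xA))).
by rewrite inE inner_connect_sym connect_root.
Qed.

End Components.

(** * Common neighbourhoods with many components *)

Definition common_nbrs (G : sgraph) (Q : {set G}) : {set G} :=
  [set x | [forall q in Q, edge q x]].

(* If every vertex of [A] has small degree in [A], then the components of [A] are
   small by [P5]-freeness, so there are many of them; otherwise descend into the
   neighbourhood of a vertex of large degree, which lowers the clique number. *)
Lemma many_components (m w : nat) : exists N : nat, forall (G : sgraph) (A : {set G}),
  ~ contains_induced G P5 -> clique_bounded A w -> N < #|A| ->
  exists Q T : {set G}, [/\ T \subset A :&: common_nbrs Q,
    separated (A :&: common_nbrs Q) T & m <= #|T|].
Proof.
elim: w => [|w [d IH]].
  exists 0 => G A _ Aw /card_gt0P[x xA]; have: #|[set x]| <= 0.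
    by apply: Aw => [|a b /set1P-> /set1P->]; rewrite ?sub1set ?eqxx.
  by rewrite cards1.
exists (m * d.+1 ^ 3) => G A noP5 Aw cA.
have [/existsP[v /andP[vA dv]]|small] :=
    boolP [exists v, (v \in A) && (d < #|A :&: nbrs v|)].
  have [Q [T]] := IH G _ noP5 (clique_bounded_nbrs vA Aw) dv.
  suff -> : A :&: nbrs v :&: common_nbrs Q = A :&: common_nbrs (v |: Q).
    by exists (v |: Q), T.
  apply/setP => x; rewrite !inE -andbA; congr (_ && _).
  apply/andP/forall_inP => [[vx /forall_inP Qx] q /setU1P[->//|/Qx]//|Qx].
  split; first by apply: Qx; rewrite setU11.
  by apply/forall_inP => q qQ; apply: Qx; rewrite setU1r.
have Ad y : y \in A -> #|A :&: nbrs y| <= d.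
  move: small; rewrite negb_exists => /forallP/(_ y).
  by rewrite negb_and -leqNgt => /orP[/negPf->|].
have [T [TA sepT mT]] := separated_of_bounded_degree noP5 Ad cA.
have A0 : A :&: common_nbrs set0 = A.
  by apply/setP => x; rewrite !inE; case: (x \in A) => //; apply/forall_inP => q; rewrite inE.
by exists set0, T; rewrite A0.
Qed.

(** * Colourings and vertex-criticality *)

Lemma colorableP (G : sgraph) (n : nat) :
  reflect (exists2 c : G -> nat, forall x, c x < n &
             forall x y, edge x y -> c x != c y)
          (colorable G n).
Proof.
apply: (iffP existsP) => [[c /forallP cP]|[c cn cP]].
  exists (fun x => val (c x)) => [x|x y xy]; first exact: ltn_ord.
  by have /forallP/(_ y) := cP x; rewrite xy.
exists [ffun x => Ordinal (cn x)].
by apply/forallP => x; apply/forallP => y; apply/implyP => xy; rewrite !ffunE cP.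
Qed.

Lemma chromatic_number_le (G : sgraph) (n : nat) :
  colorable G n -> chromatic_number G <= n.
Proof. by rewrite /chromatic_number; case: ex_minnP => k _; apply. Qed.

Lemma chromatic_number_colorable (G : sgraph) : colorable G (chromatic_number G).
Proof. by rewrite /chromatic_number; case: ex_minnP. Qed.

(** Total functions on [G] let colourings of different induced subgraphs be glued. *)
Lemma chromatic_number_induced (G : sgraph) (A : {set G}) :
  exists2 c : G -> nat, {in A, forall x, c x < chromatic_number (induced A)} &
    {in A &, forall x y, edge x y -> c x != c y}.
Proof.
have /colorableP[c cn cP] := chromatic_number_colorable (induced A).
pose c' (x : G) := if insub x is Some u then c u else 0.
have c'E x (xA : x \in A) : c' x = c (exist _ x xA) by rewrite /c' insubT.
exists c' => [x xA|x y xA yA xy]; first by rewrite c'E.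
by rewrite !c'E; apply: cP.
Qed.

Lemma chromatic_number_induced_le (G : sgraph) (A : {set G}) (c : G -> nat) (s : seq nat) :
  {in A, forall x, c x \in s} -> {in A &, forall x y, edge x y -> c x != c y} ->
  chromatic_number (induced A) <= size s.
Proof.
move=> cs cP; apply/chromatic_number_le/colorableP.
exists (fun u : induced A => index (c (val u)) s) => [[x xA]|[x xA] [y yA] xy].
  by rewrite index_mem cs.
apply: contraNneq (cP x y xA yA xy) => /= eq_ind.
by rewrite -(nth_index 0 (cs x xA)) eq_ind nth_index // cs.
Qed.

Lemma clique_le_chromatic_number (G : sgraph) :
  clique_bounded [set: G] (chromatic_number G).
Proof.
move=> K _ Kc; have /existsP[c /forallP cP] := chromatic_number_colorable G.
rewrite -[X in _ <= X]card_ord -(card_in_imset (f := c)) ?max_card // => x y xK yK.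
apply: contra_eq => xy; have /forallP/(_ y) := cP x.
by rewrite Kc.
Qed.

(* Otherwise, colour [G - A] optimally: the colours on [B] do not occur on
   the outer neighbours of [A], and there are enough of them to recolour [A]. *)
Lemma critical_obstruction (k : nat) (G : sgraph) (A B : {set G}) (a0 : G) :
  vertex_critical k G -> a0 \in A -> [disjoint A & B] ->
  chromatic_number (induced A) <= chromatic_number (induced B) ->
  exists p a b : G, [/\ p \notin A, a \in A, b \in B, edge p a & ~~ edge p b].
Proof.
move=> [Gk crit] a0A dAB chiAB.
have [/existsP[p /existsP[a /existsP[b /and5P[? ? ? ? ?]]]]|none] :=
  boolP [exists p, exists a, exists b,
    [&& p \notin A, a \in A, b \in B, edge p a & ~~ edge p b]].
  by exists p, a, b.
have complete p a b : p \notin A -> a \in A -> b \in B -> edge p a -> edge p b.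
  move=> pA aA bB pa; apply: contraNT none => pb.
  apply/existsP; exists p; apply/existsP; exists a; apply/existsP; exists b.
  by rewrite pA aA bB pa.
have BA b : b \in B -> b \notin A by move=> bB; rewrite (disjointFl dAB).
(* It suffices to colour [G] with the palette of [G - a0], which has fewer than [k] colours. As [a0]
   is in [A], the colouring [c] covers everything outside [A]. *)
have := crit a0; rewrite ltnNge -Gk => /negP[].
have [c cn cP] := chromatic_number_induced [set~ a0].
have [d dn dP] := chromatic_number_induced A.
rewrite -/(delete_vertex a0) in cn.
have A0 x : x \notin A -> x \in [set~ a0].
  by rewrite !inE; apply: contraNneq => ->.
have cnA x : x \notin A -> c x < chromatic_number (delete_vertex a0).
  by move=> xA; apply/cn/A0.
have cPA x y : x \notin A -> y \notin A -> edge x y -> c x != c y.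
  by move=> xA yA; apply: cP; apply: A0.
(* The colours used on [B], without repetition so that distinct indices are distinct colours; [d] on
   [A] serves as an index into [s]. *)
pose s := undup [seq c x | x <- enum B].
have cs x : x \in B -> c x \in s.
  by move=> xB; rewrite mem_undup map_f // mem_enum.
have ds x : x \in A -> d x < size s.
  move=> xA; apply: leq_trans (dn _ xA) (leq_trans chiAB _).
  apply: (chromatic_number_induced_le cs) => x' y' xB yB.
  by apply: cPA; apply: BA.
have sB x : x \in A -> exists2 b, b \in B & nth 0 s (d x) = c b.
  move=> xA; have := mem_nth 0 (ds x xA).
  by rewrite mem_undup => /mapP[b]; rewrite mem_enum; exists b.
(* The new colour of [x] is that of some [b] in [B], and [y], being adjacent to [x], is complete to
   [B]. *)
have cross x y : x \in A -> y \notin A -> edge y x -> nth 0 s (d x) != c y.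
  move=> xA yA yx; have [b bB ->] := sB x xA.
  rewrite eq_sym; apply: cPA => //; first exact: BA.
  exact: complete yx.
apply/chromatic_number_le/colorableP.
exists (fun x => if x \in A then nth 0 s (d x) else c x) => [x|x y xy].
  have [xA|xA] := boolP (x \in A); last exact: cnA.
  by have [b bB ->] := sB x xA; apply/cnA/BA.
have [xA|xA] := boolP (x \in A); have [yA|yA] := boolP (y \in A).
- by rewrite nth_uniq ?undup_uniq ?ds //; apply: dP.
- by apply: cross; rewrite // edge_sym.
- by rewrite eq_sym; apply: cross.
- exact: cPA.
Qed.

(** * Bounding the number of components in a critical graph *)

Lemma separated_bound (k : nat) (G : sgraph) (Q T : {set G}) :
  vertex_critical k G -> ~ contains_induced G P5 -> ~ contains_induced G chair ->
  T \subset common_nbrs Q -> separated (common_nbrs Q) T -> #|T| <= (k.+1 ^ 2).+1.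
Proof.
move=> Gcrit noP5 noChair TB sepT.
have Tin t : t \in T -> t \in common_nbrs Q by apply: (subsetP TB).
have [->|[t1 t1T]] := set_0Vmem T; first by rewrite cards0.
pose C := component (common_nbrs Q).
have Cin t x : t \in T -> x \in C t -> x \in common_nbrs Q.
  by move=> tT; apply: (subsetP (component_sub (Tin _ tT))).
have C0 t : t \in C t by rewrite inE connect0.
have [t0 t0T' t0min] :=
  arg_minnP (fun t => chromatic_number (induced (C t))) t1T.
have {t0T'} t0T : t0 \in T by [].
have anti s t x y : s \in T -> t \in T -> s != t -> x \in C s -> y \in C t ->
    ~~ edge x y.
  by move=> sT tT; apply: component_anticomplete TB sepT sT tT.
(* One simultaneous choice for each [t]: [p] sees [a] in the minimal component, misses [c] in that
   of [t], and misses [v] in [Q]. *)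
have [F FP] : exists F : G -> G * G * G * G, forall t, t \in T :\ t0 ->
    let: (p, v, a, c) := F t in
    [/\ [/\ v \in Q, a \in C t0, c \in C t & edge p a],
        ~~ edge p c, p \notin common_nbrs Q & ~~ edge p v].
  apply: (@fin_all_exists _ _ (fun t (f : G * G * G * G) => t \in T :\ t0 ->
    let: (p, v, a, c) := f in
    [/\ [/\ v \in Q, a \in C t0, c \in C t & edge p a],
        ~~ edge p c, p \notin common_nbrs Q & ~~ edge p v])) => t.
  have [/setD1P[tt0 tT]|] := boolP (t \in T :\ t0); last by exists (t, t, t, t).
  have dC : [disjoint C t0 & C t].
    rewrite -setI_eq0; apply/eqP/setP => x; rewrite !inE; apply/negP => /andP[x0 xt].
    case/eqP: tt0; apply: (component_disjoint sepT tT t0T (a := x)); by rewrite inE.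
  have [p [a [c [pA aC cC pa pc]]]] :=
    critical_obstruction Gcrit (C0 t0) dC (t0min _ tT).
  (* Inside the common neighbourhood, the edge to [a] would put [p] in [C t0]. *)
  have pB : p \notin common_nbrs Q.
    apply: contra pA => pB; apply: component_edge (Tin _ t0T) aC pB _.
    by rewrite edge_sym.
  have [v vQ vp] : exists2 v, v \in Q & ~~ edge v p.
    by move: pB; rewrite inE => /forall_inPn.
  by exists (p, v, a, c) => _; split=> //; rewrite edge_sym.
pose p t := (F t).1.1.1; pose c t := (F t).2.
have cC t : t \in T :\ t0 -> c t \in C t.
  by move/FP; rewrite /c; case: (F t) => [[[? ?] ?] ?] [[]].
have ppc t : t \in T :\ t0 -> ~~ edge (p t) (c t).
  by move/FP; rewrite /p /c; case: (F t) => [[[? ?] ?] ?] [[]].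
(* Otherwise [v] with leaves [c s], [c t] and arm [a], [p s] is an induced chair. *)
have pc s t : s \in T :\ t0 -> t \in T :\ t0 -> s != t -> edge (p s) (c t).
  move=> sT tT st; have ctC := cC t tT; apply/negPn/negP => pct; apply: noChair.
  move: (FP s sT) pct; rewrite /p; case: (F s) => [[[q v] a] d] /=.
  case=> [[vQ aC dC qa] qd qB qv] qct.
  move: sT tT => /setD1P[s0 sT] /setD1P[t'0 tT].
  have nb u x : u \in T -> x \in C u -> edge v x.
    by move=> uT xC; have := Cin _ _ uT xC; rewrite inE => /forall_inP; apply.
  apply: (contains_chair (nb _ _ t0T aC) (nb _ _ sT dC) (nb _ _ tT ctC) qa) => //.
  - apply: contraNneq st => dct; apply/eqP.
    by apply: (component_disjoint sepT sT tT dC); rewrite dct.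
  - by apply: anti aC dC; rewrite // eq_sym.
  - by apply: anti aC ctC; rewrite // eq_sym.
  - exact: anti dC ctC.
have p_inj : {in T :\ t0 &, injective p}.
  move=> s t sT tT pst; apply/eqP/negPn/negP => st.
  by have := ppc s sT; rewrite pst (pc t s) // eq_sym.
have cc s t : s \in T :\ t0 -> t \in T :\ t0 -> s != t -> ~~ edge (c s) (c t).
  move=> sT tT st; move: (cC s sT) (cC t tT).
  by case/setD1P: sT => _ sT; case/setD1P: tT => _ tT; apply: anti.
(* The outer successor in the bound accounts for [t0]; the square is the threshold of
   [three_independent] for cliques of size at most [k]. *)
rewrite (cardsD1 t0) t0T add1n ltnS leqNgt; apply/negP => big.
have Pk : clique_bounded (p @: (T :\ t0)) k.
  by move=> K _; case: (Gcrit) => <- _; apply: clique_le_chromatic_number.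
rewrite -(card_in_imset p_inj) in big.
have [_ [_ [_ [[/imsetP[x xT ->] /imsetP[y yT ->] /imsetP[z zT ->]] [dist indep]]]]] :=
  three_independent Pk big.
case: dist indep => [pxy pxz pyz] [nxy nxz nyz].
have xy : x != y by apply: contraNneq pxy => ->.
have xz : x != z by apply: contraNneq pxz => ->.
have yz : y != z by apply: contraNneq pyz => ->.
(* The 6-cycle is [c x], [p y], [c z], [p x], [c y], [p z]; dropping [p z] leaves the path. *)
apply: noP5; apply: (@contains_P5 _ (c x) (p y) (c z) (p x) (c y)).
- by rewrite edge_sym pc // eq_sym.
- exact: pc.
- by rewrite edge_sym pc.
- exact: pc.
- exact: cc.
- by rewrite edge_sym ppc.
- exact: cc.
- by rewrite edge_sym.
- exact: ppc.
- by apply: cc; rewrite // eq_sym.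
Qed.

(** * From bounded order to finitely many graphs *)

Lemma finitely_many_of_bounded_order (N : nat) (P : sgraph -> Prop) :
  (forall G : sgraph, P G -> #|G| <= N) -> finitely_many_up_to_iso P.
Proof.
move=> bound.
pose code := {n : 'I_N.+1 & {ffun 'I_n * 'I_n -> bool}}.
(* Symmetrizing the matrix and clearing its diagonal makes every code a graph, and leaves adjacency
   matrices unchanged. *)
pose e (u : code) : rel 'I_(tag u) :=
  fun i j => (i != j) && (tagged u (i, j) || tagged u (j, i)).
have e_sym u : symmetric (e u) by move=> i j; rewrite /e eq_sym orbC.
have e_irr u : irreflexive (e u) by move=> i; rewrite /e eqxx.
exists #|{: code}|, (fun i => SGraph (e_sym (enum_val i)) (e_irr (enum_val i))).
move=> G /bound GN.
pose g : {ffun 'I_#|G| * 'I_#|G| -> bool} :=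
  [ffun ij => edge (enum_val ij.1) (enum_val ij.2)].
have GN' : #|G| < N.+1 by [].
pose u : code := Tagged (fun n : 'I_N.+1 => {ffun 'I_n * 'I_n -> bool})
  (g : {ffun 'I_(Ordinal GN') * 'I_(Ordinal GN') -> bool}).
exists (enum_rank u); rewrite enum_rankK.
exists (enum_rank : G -> 'I_#|G|).
  by exists enum_val => x; rewrite ?enum_rankK ?enum_valK.
move=> x y; rewrite /= /e /= !ffunE /= !enum_rankK [edge y x]edge_sym orbb.
rewrite (inj_eq enum_rank_inj) andb_idl // => xy.
by apply: contraTneq xy => ->; rewrite edge_irr.
Qed.

Theorem theorem4 (k : nat) (hk : 1 <= k) :
  finitely_many_up_to_iso
    (fun G : sgraph => vertex_critical k G /\ free2 P5 chair G).
Proof.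
(* One more component than [separated_bound] permits; [k] bounds the cliques. *)
have [N NP] := many_components (k.+1 ^ 2).+2 k.
apply: (@finitely_many_of_bounded_order N) => G [Gcrit [noP5 noChair]].
rewrite leqNgt -cardsT; apply/negP => big.
have Gk : clique_bounded [set: G] k.
  by case: (Gcrit) => <- _; apply: clique_le_chromatic_number.
have [Q [T []]] := NP G _ noP5 Gk big.
rewrite setTI => TB sepT; apply/negP; rewrite -ltnNge ltnS.
exact: separated_bound Gcrit noP5 noChair TB sepT.
Qed.
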